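(* Let $G$ be a Polish group and let $X$ be any Borel $G$-space. Then there is a Polish $G$-space $Y$ which is Borel isomorphic to $X$ (as a Borel $G$-space).
   Context: A Polish space (group) is a separable, completely metrizable topological space (group). A standard Borel space is a Polish space with its associated Borel structure (only the $\sigma$-algebra of Borel sets is retained). For a Polish group $G$, a Borel $G$-space is a standard Borel space $X$ together with an action $G\times X\to X$, $(g,x)\mapsto g\cdot x$, of $G$ on $X$ which is a Borel map. A Polish $G$-space is a Polish space $Y$ together with an action $G\times Y\to Y$ which is continuous; every Polish $G$-space is in particular a Borel $G$-space. Two Borel $G$-spaces $X,Y$ are Borel isomorphic if there is a Borel bijection $\pi:X\to Y$ with $\pi(g\cdot x)=g\cdot\pi(x)$ for all $g\in G$, $x\in X$. *)

(* Defs.v *)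
From HB Require Import structures.
From mathcomp Require Import all_boot all_order all_algebra.
From mathcomp Require Import all_classical all_reals all_analysis.

Set Implicit Arguments.
Unset Strict Implicit.
Unset Printing Implicit Defensive.

Local Open Scope classical_set_scope.

(* None of the spaces below is required to be pointed: the empty space is a
   Polish space.  This is why the Borel structures are plain set systems and
   not instances of measurableType, and why completeType is not used. *)

Definition separable (T : topologicalType) :=
  exists2 D : set T, countable D & dense D.

(* A metric on T is given as a metricType whose carrier is T itself. *)
Definition completely_metrizable (R : realType) (T : topologicalType) :=
  exists c : Metric.axioms_ R T,
    let M : metricType R := Metric.Pack c in
    (forall x : T, @nbhs M M x = @nbhs T T x) /\
    (forall F : set_system M, ProperFilter F -> cauchy F ->
       exists l : M, F --> l).

Definition polish (R : realType) (T : topologicalType) :=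
  separable T /\ completely_metrizable R T.

HB.mixin Record isTopologicalGroup G & Topological G & Group G := {
  mulg_continuous : continuous (fun p : G * G => (p.1 * p.2)%g);
  invg_continuous : continuous (fun x : G => x^-1%g)
}.

#[short(type="topologicalGroupType")]
HB.structure Definition TopologicalGroup :=
  {G of Topological G & Group G & isTopologicalGroup G}.

Definition borel_sets (T : topologicalType) : set (set T) := <<s @open T >>.
Arguments borel_sets : clear implicits.

(* The sets in S are the Borel sets of some Polish topology on X. *)
Definition standard_borel (R : realType) (X : Type) (S : set (set X)) :=
  exists c : Topological.axioms_ X,
    let T : topologicalType := Topological.Pack c in
    polish R T /\ S = borel_sets T.

Definition borel_map (X Y : Type) (SX : set (set X)) (SY : set (set Y))
    (f : X -> Y) :=
  forall B, SY B -> SX (f @^-1` B).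

Definition prod_borel (X Y : Type) (SX : set (set X)) (SY : set (set Y)) :
    set (set (X * Y)) :=
  <<s [set A `*` B | A in SX & B in SY] >>.

Definition left_action (G : groupType) (X : Type) (act : G -> X -> X) :=
  (forall x, act 1%g x = x) /\
  (forall g h x, act (g * h)%g x = act g (act h x)).

Definition borel_Gspace (R : realType) (G : topologicalGroupType) (X : Type)
    (S : set (set X)) (act : G -> X -> X) :=
  [/\ standard_borel R S, left_action act &
      borel_map (prod_borel (borel_sets G) S) S (fun p : G * X => act p.1 p.2)].

Definition polish_Gspace (R : realType) (G : topologicalGroupType)
    (Y : topologicalType) (act : G -> Y -> Y) :=
  [/\ polish R Y, left_action act &
      continuous (fun p : G * Y => act p.1 p.2)].

(* As usual, the inverse of a Borel bijection between standard Borel spaces is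
   automatically Borel. *)
Definition borel_Gspace_isomorphic (G : groupType)
    (X : Type) (SX : set (set X)) (actX : G -> X -> X)
    (Y : Type) (SY : set (set Y)) (actY : G -> Y -> Y) :=
  exists pi : X -> Y,
    [/\ bijective pi, borel_map SX SY pi &
        forall g x, pi (actX g x) = actY g (pi x)].

(* Main.v *)
(** Let [A^U] be the Vaught transform: the set of the [x] such that
[g x] is in [A] for non-meagerly many [g] in the open set [U].  Choose a
countable Boolean algebra of Borel sets of [X] which is closed under [A |-> A^U]
for basic [U] and for which finitely consistent descriptions of points that
respect countably many prescribed countable covers are realized.  The sets
[A^U], for [A] in this algebra and [U] basic, form a base of the new topology.
Since [g A^U = A^(U g^-1)], the action is continuous; since
[(A^*V)^N] lies between an open set and a closed one for small [V] and [N], the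
topology is regular.  A decreasing sequence of pairs [(A_n, U_n)] which respects
the covers and has shrinking [U_n] determines [y] in [X] and [g] in [G], and the
sets [A_n^U_n] then shrink to [g^-1 y].  A regular space with a countable base
and such a complete sieve of open sets is Polish. *)

Require Import Defs.
From mathcomp Require Import all_boot all_order all_algebra.
From mathcomp Require Import all_classical all_reals all_analysis.
From HB Require Import structures.
From mathcomp Require Import lra.

Set Implicit Arguments.
Unset Strict Implicit.
Unset Printing Implicit Defensive.

Import Order.TTheory GRing.Theory Num.Theory.
Import numFieldNormedType.Exports.

Local Open Scope classical_set_scope.
Local Open Scope ring_scope.

(** * Metrics induced by countable families of functions *)

Lemma exp2_lt {R : realType} (e : R) : 0 < e -> exists n, 2^-1 ^+ n < e.
Proof.
move=> e0; exists (Num.bound e^-1); rewrite exprVn -[ltRHS]invrK ltf_pV2.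
- apply: lt_trans (archi_boundP _) _; first by rewrite invr_ge0 ltW.
  by rewrite -natrX ltr_nat ltn_expl.
- by rewrite posrE exprn_gt0.
- by rewrite posrE invr_gt0.
Qed.

Section family_distance.
Context {R : realType} {T : Type} {J : countType}.
Implicit Types (F : J -> T -> R) (x y z : T) (e : R).

Let wt (j : J) : R := 2^-1 ^+ pickle j.

Let wt_gt0 j : 0 < wt j. Proof. by rewrite /wt exprn_gt0// invr_gt0. Qed.

Let wt_le1 j : wt j <= 1.
Proof. by rewrite /wt exprn_ile1// ?invr_ge0// invf_le1// ler1n. Qed.

Let term F x y j : R := Num.min (wt j) `|F j x - F j y|.

(* The point 0 makes the set nonempty even if J is empty. *)
Definition fdist F x y : R := sup ([set 0] `|` range (term F x y)).

Let fdist_has_sup F x y : has_sup ([set 0] `|` range (term F x y)).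
Proof.
split; first by exists 0; left.
exists 1 => _ [->|[j _ <-]]; first exact: ler01.
by rewrite ge_min wt_le1.
Qed.

Let term_le_fdist F x y j : term F x y j <= fdist F x y.
Proof.
apply: (sup_upper_bound (fdist_has_sup F x y)).
by right; exists j.
Qed.

Let fdist_le F x y e : 0 <= e -> (forall j, term F x y j <= e) ->
  fdist F x y <= e.
Proof.
move=> e0 le; apply: ge_sup; first by case: (fdist_has_sup F x y).
by move=> _ [->//|[j _ <-]].
Qed.

Lemma fdist_ge0 F x y : 0 <= fdist F x y.
Proof. by apply: (sup_upper_bound (fdist_has_sup F x y)); left. Qed.

Lemma fdistxx F x : fdist F x x = 0.
Proof.
apply/eqP; rewrite eq_le fdist_ge0 andbT; apply: fdist_le => // j.
by rewrite /term subrr normr0 ge_min lexx orbT.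
Qed.

Lemma fdist_sym F x y : fdist F x y = fdist F y x.
Proof.
rewrite /fdist; have -> // : term F x y = term F y x.
by apply/funext => j; rewrite /term distrC.
Qed.

Lemma fdist_triangle F y x z : fdist F x z <= fdist F x y + fdist F y z.
Proof.
apply: fdist_le => [|j]; first by rewrite addr_ge0 ?fdist_ge0.
apply: le_trans (lerD (term_le_fdist F x y j) (term_le_fdist F y z j)).
have := ler_normD (F j x - F j y) (F j y - F j z); rewrite addrA subrK => tri.
have w0 := wt_gt0 j; have n1 := normr_ge0 (F j x - F j y).
have n2 := normr_ge0 (F j y - F j z).
rewrite /term !minEle; case: ifP => h1; case: ifP => h2; case: ifP => h3; lra.
Qed.

(** Below the weight of [j], the minimum in the [j]-th term is the difference of the values. This
    weight is [d], which therefore depends neither on [e] nor on the points. *)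
Lemma fdist_lt F j : exists2 d, 0 < d &
  forall e, 0 < e -> forall x y, fdist F x y < Num.min d e -> `|F j x - F j y| < e.
Proof.
exists (wt j) => // e e0 x y /(le_lt_trans (term_le_fdist F x y j)).
by rewrite /term lt_min gt_min ltxx/= => /andP[h]; rewrite min_r// ltW.
Qed.

(** The weights of indices with code at least [n] are at most [2^-n], so only finitely many [F j]
    have to be controlled. *)
Lemma fdist_cauchy F (Phi : set_system T) : Filter Phi ->
  (forall j e, 0 < e -> exists2 E, Phi E &
    forall x y, E x -> E y -> `|F j x - F j y| < e) ->
  forall e, 0 < e -> exists2 E, Phi E &
    forall x y, E x -> E y -> fdist F x y < e.
Proof.
move=> FPhi H e e0.
have [n ne] := exp2_lt (divr_gt0 e0 (ltr0n _ 2)).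
have [E PE hE] : exists2 E, Phi E & forall j, (pickle j < n)%N ->
    forall x y, E x -> E y -> `|F j x - F j y| < e / 2.
  elim: n {ne} => [|n [E PE hE]]; first by exists setT => //; exact: filterT.
  case E0 : (@pickle_inv J n) => [j|]; last first.
    exists E => // j; rewrite ltnS leq_eqVlt => /orP[/eqP jn|]; last exact: hE.
    by move: E0; rewrite -jn pickleK_inv.
  have [E' PE' hE'] := H j _ (divr_gt0 e0 (ltr0n _ 2)).
  exists (E `&` E'); first exact: filterI.
  move=> k; rewrite ltnS leq_eqVlt => /orP[/eqP kn|kn] x y [Ex E'x] [Ey E'y].
    by move: E0; rewrite -kn pickleK_inv => -[->]; exact: hE'.
  exact: hE.
exists E => // x y Ex Ey; apply: (@le_lt_trans _ _ (e / 2)); last lra.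
apply: fdist_le => [|j]; first lra.
rewrite /term ge_min; case: (ltnP (pickle j) n) => jn.
  by rewrite (ltW (hE _ jn _ _ Ex Ey)) orbT.
rewrite (le_trans _ (ltW ne))// /wt.
by rewrite ler_wiXn2l// ?invr_ge0// invf_le1// ler1n.
Qed.

End family_distance.

Definition fdist_space {R : realType} {T : choiceType} {J : countType}
  (F : J -> T -> R) (sep : forall x y, fdist F x y = 0 -> x = y) : Type := T.

Section fdist_space.
Context {R : realType} {T : choiceType} {J : countType} (F : J -> T -> R).
Hypothesis sep : forall x y, fdist F x y = 0 -> x = y.

HB.instance Definition _ := Choice.copy (fdist_space sep) T.

HB.instance Definition _ := isMetric.Build R (fdist_space sep)
  (fdistxx F) sep (fdist_sym F) (fun y x z => fdist_triangle F y x z).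

End fdist_space.

Definition osc_small {R : realType} {T : Type} (Phi : set_system T)
    (rho : T -> T -> R) :=
  forall e, 0 < e -> exists2 E, Phi E & forall x y, E x -> E y -> rho x y < e.

Lemma osc_small_continuous {R : realType} {T : topologicalType} (f : T -> R) x :
  {for x, continuous f} -> osc_small (nbhs x) (fun y z => `|f y - f z|).
Proof.
move=> fx e e0; exists [set y | `|f x - f y| < e / 2].
  have e2 : 0 < e / 2 by lra.
  exact: (@cvgr_dist_lt _ _ _ _ _ _ _ fx).
move=> y z /= xy xz; have := ler_normB (f x - f z) (f x - f y).
have -> : f x - f z - (f x - f y) = f y - f z by lra.
by move=> /le_lt_trans; apply; lra.
Qed.

(** The metric is [fdist F]. Continuity makes its balls neighbourhoods, the second hypothesis puts a
    ball into each neighbourhood, and its Cauchy filters have small oscillation under each [F j]. *)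
Lemma completely_metrizable_family {R : realType} {T : topologicalType}
    {J : countType} (F : J -> T -> R) :
  (forall j, continuous (F j)) ->
  (forall (x : T) A, nbhs x A -> exists j, exists2 e, 0 < e &
    forall y, `|F j x - F j y| < e -> A y) ->
  (forall x y : T, (forall A, nbhs x A -> A y) -> x = y) ->
  (forall Phi : set_system T, ProperFilter Phi ->
    (forall j, osc_small Phi (fun x y => `|F j x - F j y|)) ->
    exists x : T, Phi --> x) ->
  completely_metrizable R T.
Proof.
move=> Fcont Fbase T0 Fcvg.
have small (x : T) A : nbhs x A -> exists2 e, 0 < e & forall y, fdist F x y < e -> A y.
  move=> /Fbase[j [e e0 he]]; have [d d0 hd] := fdist_lt F j.
  by exists (Num.min d e); [rewrite lt_min d0|move=> y /(hd _ e0); exact: he].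
have sep x y : fdist F x y = 0 -> x = y.
  by move=> xy; apply: T0 => A /small[e e0]; apply; rewrite xy.
pose M : metricType R := fdist_space sep.
have nbhsM (x : T) : @nbhs M M x = @nbhs T T x.
  rewrite -(@metricType_numDomainType.filter_from_mdist_nbhs R M).
  apply/seteqP; split => A.
    move=> [e /= e0 eA]; have [] := @fdist_cauchy R T J F (nbhs x) (nbhs_filter x) _ e e0.
      by move=> j; exact: (osc_small_continuous (Fcont j x)).
    move=> E nE hE; apply: filterS (nE) => y Ey; apply: eA => /=.
    exact: hE (nbhs_singleton nE) Ey.
  by move=> /small[e e0 eA]; exists e => // y; exact: eA.
exists (Metric.class M); split; first exact: nbhsM.
move=> Phi PPhi /cauchyP cPhi.
have [|x Phix] := Fcvg Phi PPhi; last first.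
  by exists x => A; rewrite nbhsM; exact: Phix.
move=> j e e0; have [d d0 hd] := fdist_lt F j.
have m0 : 0 < Num.min d e / 2 by rewrite divr_gt0// lt_min d0.
have [x Phix] := cPhi _ m0; exists (@ball R M x (Num.min d e / 2)) => //.
move=> y z; rewrite !ballEmdist/= => xy xz.
apply: hd => //; apply: le_lt_trans (fdist_triangle F x y z) _.
rewrite [ltRHS]splitr ltrD//.
by move: xy; rewrite metric_sym.
Qed.

(** * Lebesgue numbers of families of sets *)

Section lebesgue_number.
Context {R : realType} {T : Type} (d : T -> T -> R).
Hypothesis d_sym : forall x y, d x y = d y x.
Hypothesis d_triangle : forall y x z, d x z <= d x y + d y z.
Implicit Types (Os : set (set T)) (x y : T) (e : R).

Let radii Os x := [set e | 0 <= e <= 1 /\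
  exists2 O, Os O & forall y, d x y < e -> O y].

(* Continuous, and positive exactly on the union of Os if its members are
   open; capping at 1 keeps it finite. *)
Definition lebesgue_number Os x : R := sup ([set 0] `|` radii Os x).

Let radii_has_sup Os x : has_sup ([set 0] `|` radii Os x).
Proof.
split; first by exists 0; left.
by exists 1 => e [->|[/andP[]]].
Qed.

Lemma lebesgue_number_ge0 Os x : 0 <= lebesgue_number Os x.
Proof. by apply: (sup_upper_bound (radii_has_sup Os x)); left. Qed.

Lemma lebesgue_number_ge Os x e O : 0 <= e <= 1 -> Os O ->
  (forall y, d x y < e -> O y) -> e <= lebesgue_number Os x.
Proof.
move=> e01 OsO h; apply: (sup_upper_bound (radii_has_sup Os x)); right.
by split => //; exists O.
Qed.

Lemma lebesgue_number_ball Os x e : 0 <= e -> e < lebesgue_number Os x ->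
  exists2 O, Os O & forall y, d x y < e -> O y.
Proof.
move=> e0 /(sup_gt (radii_has_sup Os x).1)[e' [->|[_ [ O OsO hO]]] ee'].
  by move: ee'; rewrite ltNge e0.
by exists O => // y /lt_trans /(_ ee'); exact: hO.
Qed.

Lemma lebesgue_number_lipschitz Os x y :
  `|lebesgue_number Os x - lebesgue_number Os y| <= d x y.
Proof.
suff h a b : lebesgue_number Os a <= lebesgue_number Os b + d a b.
  by have := h x y; have := h y x; rewrite (d_sym y x) ler_norml; lra.
apply: ge_sup; first exact: (radii_has_sup Os a).1.
(* Symmetry and the triangle inequality give [0 <= d a a <= 2 * d a b]. *)
have d0 : 0 <= d a b.
  by have := d_triangle b a a; have := d_triangle a a a; rewrite (d_sym b a); lra.
have l0 := lebesgue_number_ge0 Os b.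
move=> e [->|[/andP[e0 e1] [ O OsO hO]]]; first by rewrite addr_ge0.
have [ed|de] := leP e (d a b); first lra.
rewrite -lerBlDr; apply: lebesgue_number_ge OsO _; first by apply/andP; split; lra.
move=> z bz; apply: hO; apply: le_lt_trans (d_triangle b a z) _; lra.
Qed.

End lebesgue_number.

(** * Polish spaces from complete sieves *)

Lemma filter_forall_leq {T : Type} (Phi : set_system T) (P : nat -> set T) n :
  Filter Phi -> (forall j, (j <= n)%N -> Phi (P j)) ->
  Phi [set x | forall j, (j <= n)%N -> P j x].
Proof.
move=> FPhi; elim: n => [|n IH] H.
  by apply: filterS (H _ (leqnn 0)) => x P0 j; rewrite leqn0 => /eqP ->.
have h1 := IH (fun j jn => H j (leqW jn)); have h2 := H _ (leqnn n.+1).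
apply: filterS (filterI h1 h2) => x [h P1] j.
by rewrite leq_eqVlt ltnS => /orP[/eqP ->|]; [|exact: h].
Qed.

(** From each basic set with closure off [D], [U C D] removes the closures, up to that stage, of the
    basic sets whose closure misses [C]. A common point of [U A B] and [U B A], found at stages [i]
    and [j], would have been removed at the later one. *)
Lemma regular_countable_base_normal {R : realType} {T : topologicalType}
    (N : nat -> set T) :
  (forall i, open (N i)) ->
  (forall (x : T) A, nbhs x A -> exists2 i, N i x & closure (N i) `<=` A) ->
  normal_space T.
Proof.
move=> Nopen Nbase; apply/(@normal_openP R) => A B Acl Bcl AB0.
pose U (C D : set T) := [set x | exists i, [/\ closure (N i) `<=` ~` D, N i x &
  forall j, (j <= i)%N -> closure (N j) `<=` ~` C -> ~ closure (N j) x]].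
have Uopen C D : open (U C D).
  rewrite openE => x [i [iD Nix hx]].
  have : nbhs x [set y | forall j, (j <= i)%N ->
      closure (N j) `<=` ~` C -> ~ closure (N j) y].
    apply: (@filter_forall_leq _ _ (fun j => [set y |
      closure (N j) `<=` ~` C -> ~ closure (N j) y])) => j ji.
    have [jC|jC] := pselect (closure (N j) `<=` ~` C); last first.
      by apply: filterS filterT => y _ /jC.
    have ncl : nbhs x (~` closure (N j)).
      by apply: open_nbhs_nbhs; split; [exact/closed_openC/closed_closure|exact: hx].
    by apply: filterS ncl => y ncy _.
  have : nbhs x (N i) by exact: open_nbhs_nbhs.
  by move=> h1 h2; apply: filterS (filterI h1 h2) => y [Niy hy]; exists i.
have Usub C D : C `&` D = set0 -> closed D -> C `<=` U C D.
  move=> CD0 Dcl x Cx.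
  have /Nbase[i Nix iD] : nbhs x (~` D).
    apply: open_nbhs_nbhs; split; first exact: closed_openC.
    by move=> Dx; have : (C `&` D) x by []; rewrite CD0.
  by exists i; split=> // j _ /(_ x) jC /jC.
exists (U A B), (U B A); split => //; [exact: Usub|by apply: Usub; rewrite // setIC|].
rewrite -subset0 => x [[i [iB Nix hi]] [j [jA Njx hj]]].
have [ij|/ltnW ji] := leqP i j.
  by apply: (hj i) => //; exact: subset_closure.
by apply: (hi j) => //; exact: subset_closure.
Qed.

Lemma countable_base_separable {T : topologicalType} (N : nat -> set T) :
  (forall (x : T) A, nbhs x A -> exists2 i, N i x & N i `<=` A) -> separable T.
Proof.
move=> Nbase; have [[x0]|T0] := pselect (inhabited T); last first.
  exists set0 => //.
  by move=> O [x Ox]; exfalso; apply: T0.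
have [p hp] : {p : nat -> T & forall i, N i !=set0 -> N i (p i)}.
  apply: (@choice _ _ (fun i x => N i !=set0 -> N i x)) => i.
  by have [[y Ny]|n0] := pselect (N i !=set0); [exists y|exists x0 => /n0].
exists (range p); first exact: card_image_le.
move=> O [x Ox] Oopen; have /Nbase[i Nix NO] : nbhs x O by exact: open_nbhs_nbhs.
by exists (p i); split; [apply/NO/hp; exists x|exists i].
Qed.

(** Urysohn functions: if the closure of [N i] lies in [N j], then [g (i, j)] is 0 on this closure
    and 1 off [N j]. *)
Lemma regular_countable_base_bumps {R : realType} {T : topologicalType}
    (N : nat -> set T) :
  (forall i, open (N i)) ->
  (forall (x : T) A, nbhs x A -> exists2 i, N i x & closure (N i) `<=` A) ->
  exists g : nat * nat -> T -> R, (forall ij, continuous (g ij)) /\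
    forall (x : T) A, nbhs x A ->
      exists ij, forall y, `|g ij x - g ij y| < 1 -> A y.
Proof.
move=> Nopen Nbase; have normT := regular_countable_base_normal (R := R) Nopen Nbase.
have [g hg] : {g : nat * nat -> T -> R & forall ij, continuous (g ij) /\
    (closure (N ij.1) `<=` N ij.2 ->
      (forall x, closure (N ij.1) x -> g ij x = 0) /\
      (forall x, ~ N ij.2 x -> g ij x = 1))}.
  apply: (@choice _ _ (fun ij (h : T -> R) => continuous h /\
    (closure (N ij.1) `<=` N ij.2 ->
      (forall x, closure (N ij.1) x -> h x = 0) /\
      (forall x, ~ N ij.2 x -> h x = 1)))) => -[i j] /=.
  have [sub|nsub] := pselect (closure (N i) `<=` N j); last first.
    by exists (fun=> 0); split=> //; exact: cst_continuous.
  have /(@uniform_separatorP T R)[h [hcont _ h0 h1]] :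
      uniform_separator (closure (N i)) (~` N j).
    apply: (@normal_separatorP R T).1 => //; first exact: closed_closure.
      exact: open_closedC.
    by rewrite -subset0 => x [/sub].
  exists h; split=> // _; split=> x hx; first by apply: h0; exists x.
  by apply: h1; exists x.
exists g; split=> [ij|x A]; first by case: (hg ij).
move=> /Nbase[j Njx NjA].
have /Nbase[i Nix Nij] : nbhs x (N j) by exact: open_nbhs_nbhs.
exists (i, j) => y; have [_ /(_ Nij)[g0 g1]] := hg (i, j).
rewrite g0; last exact: subset_closure.
have [/subset_closure/NjA//|/g1 ->] := pselect (N j y).
by rewrite sub0r normrN normr1 ltxx.
Qed.

Lemma lebesgue_number_continuous {R : realType} {T : topologicalType}
    (d : T -> T -> R) (Os : set (set T)) :
  (forall x y, d x y = d y x) ->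
  (forall y x z, d x z <= d x y + d y z) ->
  (forall (x : T) e, 0 < e -> nbhs x [set y | d x y < e]) ->
  continuous (lebesgue_number d Os).
Proof.
move=> dsym dtri dnbhs x; apply/(@cvgrPdist_lt R R^o) => e e0.
apply: filterS (dnbhs x e e0) => y /=.
exact: le_lt_trans (lebesgue_number_lipschitz _ _ _ _ _).
Qed.

(* [1 / den (w, r, m)] is unbounded along every filter that stays 2^-m deep
   inside [f w] without staying uniformly deep inside some [f w'] with [w'] below
   [w].  Adding these functions to a family inducing the topology therefore
   makes Cauchy filters descend along the sieve. *)
Lemma completely_metrizable_sieve {R : realType} {T : topologicalType} {W : countType}
    (N : nat -> set T) (f : W -> set T) (below : nat -> W -> W -> Prop) :
  (forall i, open (N i)) ->
  (forall (x : T) A, nbhs x A -> exists2 i, N i x & closure (N i) `<=` A) ->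
  (forall x y : T, (forall A, nbhs x A -> A y) -> x = y) ->
  (forall w, open (f w)) ->
  (exists w, f w = setT) ->
  (forall r w x, f w x -> exists2 w', below r w w' & f w' x) ->
  (forall w : nat -> W,
    (forall r, below r (w r) (w r.+1)) -> (forall r, f (w r) !=set0) ->
    exists x : T, forall A, nbhs x A -> exists r, f (w r) `<=` A) ->
  completely_metrizable R T.
Proof.
move=> Nopen Nbase T0 fopen [w0 fw0] fbelow fcvg.
have [g [gcont gbase]] := regular_countable_base_bumps (R := R) Nopen Nbase.
pose d := fdist g.
have dsym : forall x y, d x y = d y x := fdist_sym g.
have dtri : forall y x z, d x z <= d x y + d y z := fdist_triangle g.
have d0 : forall x, d x x = 0 := fdistxx g.
have dnbhs (x : T) e : 0 < e -> nbhs x [set y | d x y < e].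
  move=> e0; have [|E nE hE] := @fdist_cauchy R T _ g (nbhs x) (nbhs_filter x) _ e e0.
    by move=> ij; exact: (osc_small_continuous (gcont ij x)).
  by apply: filterS (nE) => y Ey; exact: hE (nbhs_singleton nE) Ey.
have dsmall (x : T) A : nbhs x A -> exists2 e, 0 < e & forall y, d x y < e -> A y.
  move=> /gbase[ij hij]; have [e e0 he] := fdist_lt g ij.
  exists (Num.min e 1); first by rewrite lt_min e0 ltr01.
  by move=> y /(he _ ltr01); exact: hij.
pose leb := lebesgue_number d.
have lebcont Os : continuous (leb Os) by exact: lebesgue_number_continuous.
have leb_gt0 Os x O : Os O -> nbhs x O -> 0 < leb Os x.
  move=> OsO /dsmall[e e0 eO]; have m0 : 0 < Num.min e 1 by rewrite lt_min e0 ltr01.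
  apply: lt_le_trans m0 _; apply: lebesgue_number_ge OsO _.
    by rewrite le_min ltW//= ler01 ge_min lexx orbT.
  by move=> y; rewrite lt_min => /andP[/eO].
have leb_mem Os x : 0 < leb Os x -> exists2 O, Os O & O x.
  move=> l0; have [||O OsO hO] := @lebesgue_number_ball R T d Os x (leb Os x / 2).
  - by rewrite divr_ge0// ltW.
  - by rewrite ltr_pdivrMr// mulrDr mulr1 ltrDl.
  - by exists O => //; apply: hO; rewrite d0 divr_gt0.
(* The summand in [a] is twice its positive part, so it vanishes where the Lebesgue number of [f w]
   is at least [2^-m]. There the first summand is positive, since [x] lies in [f w] and so in some
   [f w'] below it. *)
pose den (wrm : W * nat * nat) x := let: (w, r, m) := wrm in
  let a := 2^-1 ^+ m - leb [set f w] x in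
  leb [set f w' | w' in below r w] x + (`|a| + a).
have exp0 m : 0 < 2^-1 ^+ m :> R by rewrite exprn_gt0// invr_gt0.
have den_gt0 wrm x : 0 < den wrm x.
  case: wrm => -[w r] m; rewrite /den.
  set a := _ - _; set s := leb _ _.
  have s0 : 0 <= s by exact: lebesgue_number_ge0.
  have [a0|a0] := ltP 0 a; first by rewrite ltr_wpDl// addr_gt0// normr_gt0 gt_eqF.
  rewrite ltr_pwDl//; last by rewrite ler0_norm// addNr.
  have [|_ -> fwx] := @leb_mem [set f w] x.
    by apply: lt_le_trans (exp0 m) _; rewrite -subr_le0.
  have [w' ww' fw'x] := fbelow r w x fwx.
  apply: (leb_gt0 _ _ (f w')); first by exists w'.
  exact: open_nbhs_nbhs.
have den_cont wrm : continuous (den wrm).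
  case: wrm => -[w r] m x; rewrite /den.
  have acont : (2^-1 ^+ m - leb [set f w] y) @[y --> x] -->
      2^-1 ^+ m - leb [set f w] x by apply: cvgB; [exact: cvg_cst|exact: lebcont].
  apply: cvgD; first exact: lebcont.
  by apply: cvgD => //; exact: cvg_norm.
pose F (j : (nat * nat) + (W * nat * nat)) :=
  match j with inl ij => g ij | inr wrm => fun x => (den wrm x)^-1 end.
apply: (@completely_metrizable_family R T _ F).
- case=> [ij|wrm] x; first exact: gcont.
  by apply: cvgV; [rewrite gt_eqF|exact: den_cont].
- by move=> x A /gbase[ij hij]; exists (inl ij), 1.
- exact: T0.
move=> Phi PPhi PhiF.
have Phid : osc_small Phi d by apply: fdist_cauchy => ij; exact: (PhiF (inl ij)).
(* A uniform form of [Phi (f w)], strong enough to make [a] nonpositive on [E]. *)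
pose deep w m := exists2 E, Phi E & forall x y, E x -> d x y < 2^-1 ^+ m -> f w y.
have step r w m : deep w m -> exists w' m', below r w w' /\ deep w' m'.
  move=> [E PE hE].
  have [E1 PE1 hE1] := PhiF (inr (w, r, m)) 1 ltr01.
  have [z [Ez E1z]] := filter_ex (filterI PE PE1).
  (* On [E1], [1 / den] varies by less than 1, so it stays below [K]. *)
  pose K := `|(den (w, r, m) z)^-1| + 1.
  have K0 : 0 < K by rewrite ltr_wpDl.
  have denK x : E1 x -> K^-1 < den (w, r, m) x.
    move=> E1x; rewrite -[ltRHS]invrK ltf_pV2 ?posrE ?invr_gt0//.
    have : `|(den (w, r, m) x)^-1 - (den (w, r, m) z)^-1| < 1 := hE1 _ _ E1x E1z.
    rewrite /K; move: (den _ x)^-1 (den _ z)^-1 => u v.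
    by have := ler_norm (u - v); have := ler_norm v; lra.
  have K1 : 0 < K^-1 by rewrite invr_gt0.
  have [n nK] := exp2_lt (divr_gt0 K1 (ltr0n R 2)).
  have [E2 PE2 hE2] := Phid _ (exp0 n).
  have [x [[Ex E1x] E2x]] := filter_ex (filterI (filterI PE PE1) PE2).
  have := denK x E1x; rewrite /den; set a := _ - _.
  have a0 : a <= 0.
    rewrite subr_le0; apply: (@lebesgue_number_ge _ _ _ _ _ _ (f w)) => //.
      by rewrite ltW//= exprn_ile1// ?invr_ge0// invf_le1// ler1n.
    by move=> y; exact: hE.
  (* The ball of radius [1 / K] about [x] lies in some [f w']. Half of the radius covers the
     diameter of [E2]; the other half exceeds the new depth [2^-n]. *)
  rewrite ler0_norm// addNr addr0 => /(lebesgue_number_ball (ltW K1))[_ [w' ww' <-] hw'].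
  exists w', n; split=> //; exists E2 => // y u E2y yu; apply: hw'.
  apply: le_lt_trans (dtri y x u) _.
  by have := hE2 _ _ E2x E2y; move: yu nK; lra.
have [next hnext] : {next : nat * (W * nat) -> W * nat &
    forall rwm, deep rwm.2.1 rwm.2.2 ->
      below rwm.1 rwm.2.1 (next rwm).1 /\ deep (next rwm).1 (next rwm).2}.
  apply: (@choice _ _ (fun (rwm : nat * (W * nat)) (wm : W * nat) =>
    deep rwm.2.1 rwm.2.2 -> below rwm.1 rwm.2.1 wm.1 /\ deep wm.1 wm.2)).
  move=> [r [w m]] /=; have [/step|nd] := pselect (deep w m); last by exists (w, m).
  by move=> /(_ r)[w' [m' ?]]; exists (w', m').
pose wm := fix wm r := if r is r'.+1 then next (r', wm r') else (w0, 0%N).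
have wm_deep r : deep (wm r).1 (wm r).2.
  elim: r => [|r IH]; last by have [] := hnext (r, wm r) IH.
  by exists setT; [exact: filterT|rewrite /= fw0].
have Phi_f r : Phi (f (wm r).1).
  have [E PE hE] := wm_deep r; apply: filterS PE => x Ex.
  by apply: (hE x x Ex); rewrite d0.
have [||x hx] := fcvg (fun r => (wm r).1).
- by move=> r; have [] := hnext (r, wm r) (wm_deep r).
- by move=> r; exact: filter_ex (Phi_f r).
by exists x => A /hx[r rA]; exact: filterS rA (Phi_f r).
Qed.

Lemma polish_sieve {R : realType} {T : topologicalType} {W : countType}
    (N : nat -> set T) (f : W -> set T) (below : nat -> W -> W -> Prop) :
  (forall i, open (N i)) ->
  (forall (x : T) A, nbhs x A -> exists2 i, N i x & closure (N i) `<=` A) ->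
  (forall x y : T, (forall A, nbhs x A -> A y) -> x = y) ->
  (forall w, open (f w)) ->
  (exists w, f w = setT) ->
  (forall r w x, f w x -> exists2 w', below r w w' & f w' x) ->
  (forall w : nat -> W,
    (forall r, below r (w r) (w r.+1)) -> (forall r, f (w r) !=set0) ->
    exists x : T, forall A, nbhs x A -> exists r, f (w r) `<=` A) ->
  polish R T.
Proof.
move=> Nopen Nbase T0 fopen ftop fbelow fcvg; split.
  apply: (@countable_base_separable T N) => x A /Nbase[i Nix NA].
  by exists i => //; exact: subset_trans (@subset_closure _ _) NA.
exact: completely_metrizable_sieve Nopen Nbase T0 fopen ftop fbelow fcvg.
Qed.

(** * Baire category *)

Lemma generated_sigma_algebra_ind {X : Type} (Gs : set (set X)) (P : set X -> Prop) :
  (forall A, Gs A -> P A) -> P set0 -> (forall A, P A -> P (~` A)) ->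
  (forall F : nat -> set X, (forall n, P (F n)) -> P (\bigcup_n F n)) ->
  forall A, <<s Gs >> A -> P A.
Proof.
move=> Pg P0 PC PU; apply: smallest_sub => //; split => // A.
by rewrite setTD; exact: PC.
Qed.

Section sigma_closed.
Context {X : Type}.

Definition sigma_closed (S : set (set X)) :=
  (forall A, S A -> S (~` A)) /\
  (forall (I : countType) (F : I -> set X), (forall i, S (F i)) -> S (\bigcup_i F i)).

Lemma generated_sigma_closed (Gs : set (set X)) : sigma_closed <<s Gs >>.
Proof.
have [S0 SC SU] := smallest_sigma_algebra setT Gs.
split=> [A /SC|I F SF]; first by rewrite setTD.
pose F' n := if unpickle n is Some i then F i else set0.
have -> : \bigcup_i F i = \bigcup_n F' n.
  apply/seteqP; split=> [x [i _ Fx]|x [n _]].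
    by exists (pickle i) => //; rewrite /F' pickleK.
  by rewrite /F'; case: unpickle => // i Fx; exists i.
by apply: SU => n; rewrite /F'; case: unpickle.
Qed.

Lemma sigma_closedI S A B : sigma_closed S -> S A -> S B -> S (A `&` B).
Proof.
move=> [SC SU] SA SB; have -> : A `&` B = ~` \bigcup_c (if c then ~` A else ~` B).
  apply/seteqP; split=> [x [Ax Bx] [[] _ []] //|x h]; split; apply: contrapT => nx.
    by apply: h; exists true.
  by apply: h; exists false.
by apply: (SC); apply: SU => -[]; exact: SC.
Qed.

End sigma_closed.

(* A metric-free presentation of a Polish space: [fine r i] says that the basic
   set [b i] has diameter less than 2^-r. *)
Record sieve_base (T : topologicalType) (b : nat -> set T)
    (fine : nat -> nat -> Prop) : Prop := SieveBase {
  sb_top : exists i, b i = setT;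
  sb_open : forall i, open (b i);
  sb_nbhs : forall (x : T) A r, nbhs x A ->
    exists i, [/\ b i x, closure (b i) `<=` A & fine r i];
  sb_cvg : forall a : nat -> set T, (forall n, a n.+1 `<=` a n) ->
    (forall n, a n !=set0) ->
    (forall r, exists i, fine r i /\ exists n, a n `<=` b i) ->
    exists x : T, forall A, nbhs x A -> exists n, a n `<=` A;
  sb_sep : forall x y : T, x <> y ->
    exists r, forall i, fine r i -> b i x -> ~ b i y }.

Lemma decreasing_seqS {T : Type} (a : nat -> set T) m n :
  (forall n, a n.+1 `<=` a n) -> (m <= n)%N -> a n `<=` a m.
Proof.
move=> adec /subnK <-; elim: (n - m)%N => // k IH.
by rewrite addSn; exact: subset_trans (adec _) IH.
Qed.

Lemma polish_sieve_base {R : realType} {T : topologicalType} :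
  polish R T -> exists b fine, @sieve_base T b fine.
Proof.
case=> -[D /countable_injP[f finj] Ddense] [c].
set M : metricType R := Metric.Pack c => -[nbhsM cmpl].
pose d : T -> T -> R := @mdist R M.
have dsym : forall x y, d x y = d y x := @metric_sym R M.
have dtri : forall x y z, d x z <= d x y + d y z := @metric_triangle R M.
have dxx : forall x, d x x = 0 := @mdistxx R M.
have nbhsd (x : T) A : nbhs x A <-> exists2 e, 0 < e & forall y, d x y < e -> A y.
  by rewrite -nbhsM -(@metricType_numDomainType.filter_from_mdist_nbhs R M).
have exp0 k : 0 < 2^-1 ^+ k :> R by rewrite exprn_gt0// invr_gt0.
(* The code [(n, k)] stands for the ball of radius [2^-k] about the dense point numbered [n] by [f];
   all other indices stand for the whole space. *)
pose b i : set T :=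
  if (unpickle i : option (option (nat * nat))) is Some (Some (n, k))
  then [set y | exists x, [/\ D x, f x = n & d x y < 2^-1 ^+ k]] else setT.
pose fine r i := forall x y, b i x -> b i y -> d x y < 2^-1 ^+ r.
exists b, fine; split.
- by exists (pickle (None : option (nat * nat))); rewrite /b pickleK.
- move=> i; rewrite /b; case: unpickle => [[[n k]|]|]; try exact: openT.
  rewrite openE => y [x [Dx fx xy]]; apply/nbhsd.
  exists (2^-1 ^+ k - d x y); first by rewrite subr_gt0.
  move=> z yz; exists x; split=> //; apply: le_lt_trans (dtri x y z) _; lra.
- move=> x A r /nbhsd[e e0 eA].
  (* Three radii bound the distance from [x] to a point in the closure of the ball, and two bound
     its diameter; a factor 4 suffices for both. *)
  have m0 : 0 < Num.min e (2^-1 ^+ r) / 4 by rewrite divr_gt0// lt_min e0 exp0.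
  have [k hk] := exp2_lt m0.
  have [ke kr] : 4 * 2^-1 ^+ k < e /\ 4 * 2^-1 ^+ k < 2^-1 ^+ r :> R.
    by move: hk; rewrite ltr_pdivlMr// lt_min mulrC => /andP[].
  have kp := exp0 k.
  have [p [xp Dp]] : [set y | d x y < 2^-1 ^+ k]^° `&` D !=set0.
    apply: Ddense; last exact: open_interior.
    by exists x; apply/nbhsd; exists (2^-1 ^+ k).
  have {}xp := interior_subset xp.
  exists (pickle (Some (f p, k))); have bE y :
      b (pickle (Some (f p, k))) y <-> d p y < 2^-1 ^+ k.
    rewrite /b pickleK; split=> [[q [Dq fq]]|py]; last by exists p.
    by rewrite (finj q p)// inE.
  split.
  + by apply/bE; rewrite dsym.
  + move=> y cy; apply: eA.
    have [|z [/bE pz yz]] := cy [set z | d y z < 2^-1 ^+ k].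
      by apply/nbhsd; exists (2^-1 ^+ k).
    move: xp yz; rewrite /= (dsym y z) => xp yz.
    by have := dtri x p y; have := dtri p z y; lra.
  + move=> y z /bE py /bE pz; have := dtri y p z; rewrite (dsym y p); lra.
- move=> a adec ane afine.
  pose Phi : set_system M := [set A | exists n, a n `<=` A].
  have PPhi : ProperFilter Phi.
    apply: Build_ProperFilter_ex => [A [n nA]|].
      by have [x ax] := ane n; exists x; exact: nA.
    split; first by exists 0%N.
    + move=> A B [m mA] [n nB]; exists (maxn m n) => x ax; split.
        by apply/mA/(decreasing_seqS adec (leq_maxl m n)).
      by apply/nB/(decreasing_seqS adec (leq_maxr m n)).
    + by move=> A B AB [n nA]; exists n; exact: subset_trans AB.
  have [|l Phil] := cmpl Phi PPhi.
    apply/cauchyP => e e0; have [r re] := exp2_lt e0.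
    have [i [fi [n ni]]] := afine r; have [x ax] := ane n.
    exists x, n => y ay; rewrite ballEmdist/=.
    by apply: lt_trans re; apply: fi; exact: ni.
  by exists l => A; rewrite -nbhsM => /Phil.
- move=> x y xy; have d0 : 0 < d x y by rewrite /d mdist_gt0; exact/eqP.
  have [r rxy] := exp2_lt d0; exists r => i fi bx /(fi _ _ bx).
  by move=> /lt_trans /(_ rxy); rewrite ltxx.
Qed.

(** * Meagre sets *)

Section meager.
Context {T : topologicalType}.
Implicit Types (A E U : set T).

Definition nowhere_dense E := forall U, open U -> U !=set0 ->
  exists V, [/\ open V, V !=set0, V `<=` U & V `&` E = set0].

Definition meager E := exists F : nat -> set T,
  (forall n, nowhere_dense (F n)) /\ E `<=` \bigcup_n F n.

Lemma meagerS A E : A `<=` E -> meager E -> meager A.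
Proof. by move=> AE [F [Fnd EF]]; exists F; split=> //; exact: subset_trans EF. Qed.

Lemma nowhere_dense0 : nowhere_dense set0.
Proof. by move=> U Uo U0; exists U; split; rewrite ?setI0. Qed.

Lemma nowhere_dense_meager E : nowhere_dense E -> meager E.
Proof. by move=> Ed; exists (fun=> E); split=> // x Ex; exists 0%N. Qed.

Lemma meager0 : meager set0.
Proof. exact/nowhere_dense_meager/nowhere_dense0. Qed.

Lemma meager_bigcup (I : countType) (E : I -> set T) :
  (forall i, meager (E i)) -> meager (\bigcup_i E i).
Proof.
move=> /choice[F hF].
pose F' n := if unpickle n is Some (i, k) then F i k else set0.
exists F'; split=> [n|x [i _ Ex]].
  rewrite /F'; case: unpickle => [[i k]|]; first exact: (hF i).1.
  exact: nowhere_dense0.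
have [k _ Fx] := (hF i).2 x Ex.
by exists (pickle (i, k)) => //; rewrite /F' pickleK.
Qed.

Lemma meagerU A E : meager A -> meager E -> meager (A `|` E).
Proof.
move=> mA mE; apply: (@meagerS _ (\bigcup_c (if c then A else E))).
  by move=> x [Ax|Ex]; [exists true|exists false].
by apply: meager_bigcup => -[].
Qed.

Lemma nonmeager_cover (I : countType) E (F : I -> set T) :
  ~ meager E -> E `<=` \bigcup_i F i -> exists i, ~ meager (F i).
Proof.
move=> nE EF; apply: contrapT => nF; apply: nE; apply: meagerS EF _.
by apply: meager_bigcup => i; apply: contrapT => nm; apply: nF; exists i.
Qed.

Lemma nonmeager_nonempty E : ~ meager E -> E !=set0.
Proof.
move=> nE; apply/set0P/eqP => E0; apply: nE; rewrite E0; exact: meager0.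
Qed.

Lemma meager_preimage_homeo (h k : T -> T) E : continuous h -> continuous k ->
  cancel h k -> cancel k h -> meager E -> meager (h @^-1` E).
Proof.
move=> hc kc hk kh [F [Fnd EF]]; exists (fun n => h @^-1` F n).
split=> [n U Uo [x Ux]|x /EF[n _ Fx]]; last by exists n.
have kUo : open (k @^-1` U) by apply: open_comp => // z _; exact: kc.
have kU0 : k @^-1` U !=set0 by exists (h x); rewrite /preimage/= hk.
have [V [Vo [y Vy] VU VF]] := Fnd n _ kUo kU0.
exists (h @^-1` V); split.
- by apply: open_comp => // z _; exact: hc.
- by exists (k y); rewrite /= kh.
- by move=> z /VU; rewrite /= hk.
- by rewrite -preimage_setI VF preimage_set0.
Qed.

End meager.

Lemma sieve_base_limit_closure {T : topologicalType} (a : nat -> set T) (x : T) n :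
  (forall n, a n.+1 `<=` a n) -> (forall n, a n !=set0) ->
  (forall A, nbhs x A -> exists n, a n `<=` A) -> closure (a n) x.
Proof.
move=> adec ane ax A /ax[m mA]; have [y ay] := ane (maxn m n).
exists y; split; first exact: (decreasing_seqS adec (leq_maxr m n)).
exact/mA/(decreasing_seqS adec (leq_maxl m n)).
Qed.

Section sieve_base_baire.
Context {T : topologicalType} {b : nat -> set T} {fine : nat -> nat -> Prop}.
Hypothesis sb : @sieve_base T b fine.
Implicit Types (E U : set T).

(** Starting inside [U], each step picks a basic set which is fine of order [n], misses [F n] and
    has its closure in the previous one. The limit point lies in all of them, hence in [U] but in no
    [F n]. *)
Lemma sieve_base_baire U : open U -> U !=set0 -> ~ meager U.
Proof.
move=> Uo [x Ux] [F [Fnd UF]].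
have [i0 [bi0 i0U _]] := sb_nbhs sb 0%N (open_nbhs_nbhs (conj Uo Ux)).
have step n i : exists j, b i !=set0 ->
    [/\ b j !=set0, closure (b j) `<=` b i, fine n j & b j `&` F n = set0].
  have [bi|nbi] := pselect (b i !=set0); last by exists 0%N => /nbi.
  have [V [Vo [y Vy] Vb VF]] := Fnd n (b i) (sb_open sb i) bi.
  have [j [bj jV fj]] := sb_nbhs sb n (open_nbhs_nbhs (conj Vo Vy)).
  exists j => _; split=> //; first by exists y.
    exact: subset_trans Vb.
  by apply: subsetI_eq0 VF => //; exact: subset_trans (@subset_closure _ _) jV.
have [next hnext] := choice (fun ni : nat * nat => step ni.1 ni.2).
pose s := fix s n := if n is n'.+1 then next (n', s n') else i0.
have sne n : b (s n) !=set0.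
  by elim: n => [|n /(hnext (n, s n))[]]; first by exists x.
have scl n : closure (b (s n.+1)) `<=` b (s n).
  by have [] := hnext (n, s n) (sne n).
have sdec n : b (s n.+1) `<=` b (s n).
  exact: subset_trans (@subset_closure _ _) (scl n).
have [|z hz] := @sb_cvg _ _ _ sb (b \o s) sdec sne.
  move=> r; exists (s r.+1); split; first by have [] := hnext (r, s r) (sne r).
  by exists r.+1.
have sz n : b (s n) z.
  by apply: scl; exact: (@sieve_base_limit_closure _ (b \o s) _ n.+1 sdec sne hz).
have /UF[n _ Fz] : U z by apply: i0U; exact/subset_closure/(sz 0%N).
have [_ _ _ F0] := hnext (n, s n) (sne n).
by have : (b (s n.+1) `&` F n) z by []; rewrite F0.
Qed.

(* Every set with the Baire property has this property; stated in this form it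
   is inherited by complements and countable unions without decomposing a set
   into an open set up to a meager one. *)
Definition locally_comeager (E : set T) := forall U, open U ->
  ~ meager (U `&` E) ->
  exists i, [/\ b i `<=` U, b i !=set0 & meager (b i `&` ~` E)].

Lemma locally_comeager_open E : open E -> locally_comeager E.
Proof.
move=> Eo U Uo /nonmeager_nonempty[x [Ux Ex]].
have [i [bi iUE _]] := sb_nbhs sb 0%N (open_nbhs_nbhs (conj (openI Uo Eo) (conj Ux Ex))).
have sub : b i `<=` U `&` E by exact: subset_trans (@subset_closure _ _) iUE.
exists i; split; [by move=> y /sub[]|by exists x|].
apply: meagerS (meager0); by move=> y [/sub[]].
Qed.

(** Let [O] be the union of the basic subsets of [U] in which [E] is comeagre. If the claim failed,
    [E] would be nonmeagre in each nonempty basic subset of [U], so [O] would be dense in [U]. The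
    part of [U] off [E] would then be meagre, being covered by a nowhere dense set and a meagre part
    of [O]. *)
Lemma locally_comeager_setC E : locally_comeager E -> locally_comeager (~` E).
Proof.
move=> El U Uo nUE; apply: contrapT => nV; apply: nUE.
pose P i := b i `<=` U /\ meager (b i `&` ~` E).
pose O := \bigcup_(i in P) b i.
have Oo : open O by apply: bigcup_open => i _; exact: (sb_open sb).
have mO : meager (O `&` ~` E).
  apply: (@meagerS _ _ (\bigcup_i (if pselect (P i) then b i `&` ~` E else set0))).
    by move=> x [[i Pi bix] Ex]; exists i => //; case: pselect.
  apply: meager_bigcup => i; case: (pselect (P i)) => [[biU mi]|nP] /=.
    exact: mi.
  exact: meager0.
apply: (@meagerS _ _ ((U `\` O) `|` (O `&` ~` E))).
  by move=> x [Ux Ex]; have [Ox|nOx] := pselect (O x); [right|left].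
apply: meagerU mO; apply: nowhere_dense_meager => V Vo V0.
have [VU0|VU] := pselect (V `&` U = set0).
  exists V; split=> //; rewrite -subset0 => x [Vx [Ux _]].
  by rewrite -VU0.
have {VU}[x [Vx Ux]] : V `&` U !=set0 by apply/set0P/eqP.
have [j [bj jVU _]] := sb_nbhs sb 0%N (open_nbhs_nbhs (conj (openI Vo Uo) (conj Vx Ux))).
have sub : b j `<=` V `&` U by exact: subset_trans (@subset_closure _ _) jVU.
have [|i [ij i0 mi]] := El (b j) (sb_open sb j).
  move=> mj; apply: nV; exists j; split; first by move=> y /sub[].
    by exists x.
  by rewrite setCK.
exists (b i); split=> //; first exact: (sb_open sb).
  by move=> y /ij/sub[].
rewrite -subset0 => y [biy [_ nO]]; apply: nO; exists i => //; split=> //.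
by move=> z /ij/sub[].
Qed.

Lemma locally_comeager_bigcup (F : nat -> set T) :
  (forall n, locally_comeager (F n)) -> locally_comeager (\bigcup_n F n).
Proof.
move=> Fl U Uo nUF.
have [|n nn] := @nonmeager_cover _ nat _ (fun n => U `&` F n) nUF.
  by move=> x [Ux [n _ Fx]]; exists n.
have [i [iU i0 mi]] := Fl n U Uo nn; exists i; split=> //.
by apply: meagerS mi => x [bx nF]; split=> // Fx; apply: nF; exists n.
Qed.

Lemma locally_comeagerI E F :
  locally_comeager E -> locally_comeager F -> locally_comeager (E `&` F).
Proof.
move=> El Fl.
have -> : E `&` F = ~` \bigcup_n (if n is 0%N then ~` E else ~` F).
  apply/seteqP; split=> [x [Ex Fx] [[|n] _ []] //|x h]; split; apply: contrapT => nx.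
    by apply: h; exists 0%N.
  by apply: h; exists 1%N.
apply: locally_comeager_setC; apply: locally_comeager_bigcup => -[|n];
  exact: locally_comeager_setC.
Qed.

Lemma locally_comeager_borel E : borel_sets T E -> locally_comeager E.
Proof.
apply: generated_sigma_algebra_ind; first exact: locally_comeager_open.
- exact/locally_comeager_open/open0.
- exact: locally_comeager_setC.
- exact: locally_comeager_bigcup.
Qed.

End sieve_base_baire.
Arguments locally_comeager {T} b E.

(** * Countable algebras of Borel sets *)

(** The closure consists of the values of binary trees with generators at the leaves and operations
    at the nodes. Ill-formed nodes and undecodable indices are given generators as values, which
    preserves the induction principle. *)
Lemma countable_closure {X : Type} (base : nat -> set X)
    (op : nat -> set X -> set X -> set X) :
  exists e : nat -> set X, [/\ forall k, exists n, e n = base k,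
    forall k m n, exists l, e l = op k (e m) (e n) &
    forall P : set X -> Prop, (forall k, P (base k)) ->
      (forall k A B, P A -> P B -> P (op k A B)) -> forall n, P (e n)].
Proof.
pose eval := fix eval (t : GenTree.tree nat) : set X :=
  match t with
  | GenTree.Leaf k => base k
  | GenTree.Node k [:: s; t'] => op k (eval s) (eval t')
  | GenTree.Node k _ => base k
  end.
pose e n := if unpickle n is Some t then eval t else base n.
have ek t : e (pickle t) = eval t by rewrite /e pickleK.
exists e; split=> [k|k m n|P Pb Pop].
- by exists (pickle (GenTree.Leaf k)); rewrite ek.
- have eE l : exists t, e l = eval t.
    by rewrite /e; case: unpickle => [t|]; [exists t|exists (GenTree.Leaf l)].
  have [[s ->] [t ->]] := (eE m, eE n).
  by exists (pickle (GenTree.Node k [:: s; t])); rewrite ek.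
have Peval : forall t, P (eval t).
  fix IH 1 => -[k|k [|s [|t [|u ts]]]] /=; [exact: Pb|exact: Pb|exact: Pb| |exact: Pb].
  by apply: Pop; exact: IH.
by move=> n; rewrite /e; case: unpickle => [t|].
Qed.

Section borel_algebra.
Context {T : topologicalType} {b : nat -> set T} {fine : nat -> nat -> Prop}.
Hypothesis sb : @sieve_base T b fine.

Let S := borel_sets T.

Let SC : forall A, S A -> S (~` A) := (@generated_sigma_closed T open).1.

Let SU : forall (I : countType) (F : I -> set T),
  (forall i, S (F i)) -> S (\bigcup_i F i) := (@generated_sigma_closed T open).2.

Let Sopen A : open A -> S A. Proof. by move=> Ao; exact: sub_gen_smallest. Qed.

(* The covers c i decide A: once the decreasing sets a n, shrinking to y, enter
   a member of each cover, they enter A or its complement, according to y. *)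
Definition decided_by (c : nat -> nat -> set T) (A : set T) :=
  [/\ forall i j, S (c i j), forall i, \bigcup_j c i j = setT &
    forall a : nat -> set T, (forall n, a n.+1 `<=` a n) ->
      (forall n, a n !=set0) -> (forall i, exists j n, a n `<=` c i j) ->
      forall y : T, (forall O, nbhs y O -> exists n, a n `<=` O) ->
      (A y -> exists n, a n `<=` A) /\ (~ A y -> exists n, a n `<=` ~` A)].

(** Besides the complement of [O], the cover has the closures of basic sets that lie in [O]. If some
    [a n] enters such a closure, the limit [y] belongs to it too, and so to [O]. *)
Let decided_open O : open O -> exists c, decided_by c O.
Proof.
move=> Oo; pose c (i j : nat) := if j is k.+1 then
  [set x | closure (b k) `<=` O /\ closure (b k) x] else ~` O.
exists c; split=> [i [|k]|i|a adec ane ac y ay].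
- by apply: SC; exact: Sopen.
- rewrite /c; have [kO|kO] := pselect (closure (b k) `<=` O); last first.
    rewrite (_ : [set _ | _] = set0); first by apply: Sopen; exact: open0.
    by rewrite -subset0 => x [/kO].
  rewrite (_ : [set _ | _] = ~` ~` closure (b k)).
    apply: SC; apply: Sopen; exact/closed_openC/closed_closure.
  by rewrite setCK; apply/seteqP; split=> [x []//|x].
- rewrite -subTset => x _; have [Ox|nOx] := pselect (O x); last by exists 0%N.
  have [k [bk kO _]] := sb_nbhs sb 0%N (open_nbhs_nbhs (conj Oo Ox)).
  by exists k.+1 => //; split=> //; exact: subset_closure.
- split=> [Oy|nOy]; first by apply: ay; exact: open_nbhs_nbhs.
  have [[|k] [n nc]] := ac 0%N; first by exists n.
  have [x /nc[kO _]] := ane n.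
  exfalso; apply/nOy/kO; rewrite ((closure_id (closure (b k))).1 _);
    last exact: closed_closure.
  have := sieve_base_limit_closure n adec ane ay.
  by apply: closureS => z /nc[].
Qed.

Let decided_setC A : (exists c, decided_by c A) -> exists c, decided_by c (~` A).
Proof.
move=> [c [Sc cT ca]]; exists c; split=> // a adec ane ac y ay.
have [h1 h2] := ca a adec ane ac y ay; rewrite setCK; split=> // nnAy.
by apply: h1; exact: contrapT.
Qed.

(** Cover 0 consists of all [F k] and the complement of their union; the other covers decide the
    single [F n]. If [y] is in no [F n], entering [F k] through cover 0 contradicts entering its
    complement. *)
Let decided_bigcup (F : nat -> set T) : (forall n, S (F n)) ->
  (forall n, exists c, decided_by c (F n)) -> exists c, decided_by c (\bigcup_n F n).
Proof.
move=> SF /choice[cF cFP].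
pose c i j := match i with
  | 0%N => if j is k.+1 then F k else ~` \bigcup_n F n
  | i'.+1 => if unpickle i' is Some (n, k) then cF n k j else setT
  end.
have SF' : S (\bigcup_n F n) by exact: SU.
exists c; split=> [i j|i|a adec ane ac y ay].
- case: i => [|i] /=; first by case: j => [|k] //; exact: SC.
  case: unpickle => [[n k]|]; last by apply: Sopen; exact: openT.
  by have [] := cFP n.
- case: i => [|i] /=; last first.
    case: unpickle => [[n k]|]; first by have [] := cFP n.
    by rewrite -subTset => x _; exists 0%N.
  rewrite -subTset => x _; have [[k _ Fx]|nF] := pselect ((\bigcup_n F n) x).
    by exists k.+1.
  by exists 0%N.
have dF n : (F n y -> exists m, a m `<=` F n) /\ (~ F n y -> exists m, a m `<=` ~` F n).
  have [_ _] := cFP n; apply=> // k.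
  by have := ac (pickle (n, k)).+1; rewrite /c pickleK.
split=> [[n _ /(dF n).1[m mF]]|nF].
  by exists m => x /mF Fx; exists n.
have [[|k] [n nc]] := ac 0%N; first by exists n.
have [m mF] : exists m, a m `<=` ~` F k by apply: (dF k).2 => Fy; apply: nF; exists k.
have [x ax] := ane (maxn m n); exfalso.
have /mF := decreasing_seqS adec (leq_maxl m n) ax.
by apply; apply: nc; exact: decreasing_seqS adec (leq_maxr m n) _ ax.
Qed.

Lemma borel_decided A : S A -> exists c, decided_by c A.
Proof.
move=> SA; suff [] : S A /\ exists c, decided_by c A by [].
move: A SA; apply: generated_sigma_algebra_ind.
- by move=> O Oo; split; [exact: Sopen|exact: decided_open].
- by split; [by apply: Sopen; exact: open0|exact/decided_open/open0].
- by move=> A [SA dA]; split; [exact: SC|exact: decided_setC].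
- move=> F SF; split; first by apply: SU => n; exact: (SF n).1.
  by apply: decided_bigcup => n; [exact: (SF n).1|exact: (SF n).2].
Qed.

(** The family is also closed under passing from a member to the sets in the covers deciding it. So
    the covers [c] consist of members and decide all members, while those made of fine basic sets
    provide the limit [y]. *)
Lemma borel_algebra (op : nat -> set T -> set T -> set T) :
  (forall k A B, S A -> S B -> S (op k A B)) ->
  exists (e : nat -> set T) (c : nat -> nat -> set T),
  [/\ (forall n, S (e n)) /\ (forall k m n, exists l, e l = op k (e m) (e n)),
    forall r j, exists n, e n = c r j, forall r, \bigcup_j c r j = setT,
    forall a : nat -> set T, (forall n, a n.+1 `<=` a n) ->
      (forall n, a n !=set0) -> (forall r, exists j n, a n `<=` c r j) ->
      exists y : T, forall n, e n y -> exists m, a m `<=` e n &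
    forall x y, x <> y -> exists2 n, e n x & ~ e n y].
Proof.
move=> Sop.
have [cert certP] : {cert : set T -> nat -> nat -> set T &
    forall A, S A -> decided_by (cert A) A}.
  apply: (@choice _ _ (fun A c => S A -> decided_by c A)) => A.
  have [/borel_decided[c cA]|nSA] := pselect (S A); first by exists c.
  by exists (fun _ _ => A) => /nSA.
(* Empty unless [b i] is fine of order [r]. *)
pose fb r i := [set x | fine r i /\ b i x].
have Sfb r i : S (fb r i).
  rewrite /fb; have [f|nf] := pselect (fine r i).
    rewrite (_ : [set _ | _] = b i); first by apply: Sopen; exact: (sb_open sb).
    by apply/seteqP; split=> [x []//|x].
  rewrite (_ : [set _ | _] = set0); first by apply: Sopen; exact: open0.
  by rewrite -subset0 => x [].
have fbT r (x : T) : exists2 i, fine r i & b i x.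
  by have [i [bi _ fi]] := sb_nbhs sb r (@filterT _ (nbhs x) _); exists i.
pose op' k (A B : set T) := match unpickle k : option (nat + nat * nat) with
  | Some (inl k') => op k' A B
  | Some (inr (i, j)) => if pselect (S A) then cert A i j else A
  | None => A end.
pose base k := if unpickle k is Some (r, i) then fb r i else set0.
have [e [ebase eop eind]] := countable_closure base op'.
have Se n : S (e n).
  apply: eind => [k|k A B SA SB].
    by rewrite /base; case: unpickle => [[r i]|]; [exact: Sfb|by apply: Sopen; exact: open0].
  rewrite /op'; case: unpickle => [[k'|[i j]]|]//; first exact: Sop.
  by case: (pselect (S A)) => SA' //=; have [] := certP A SA.
pose c r := match unpickle r : option (nat + nat * nat) with
  | Some (inl r') => fb r'
  | Some (inr (n, i)) => cert (e n) i
  | None => fb 0%N end.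
have cfb r : \bigcup_j fb r j = setT.
  by rewrite -subTset => x _; have [i fi bi] := fbT r x; exists i.
exists e, c; split.
- split=> // k m n; have [l le] := eop (pickle (inl k : nat + nat * nat)) m n.
  by exists l; rewrite le /op' pickleK.
- have efb r j : exists n, e n = fb r j.
    by have [n nE] := ebase (pickle (r, j)); exists n; rewrite nE /base pickleK.
  move=> r j; rewrite /c; case: unpickle => [[r'|[n i]]|]; [exact: efb| |exact: efb].
  have [l le] := eop (pickle (inr (i, j) : nat + nat * nat)) n n.
  by exists l; rewrite le /op' pickleK; case: (pselect (S (e n))).
- move=> r; rewrite /c; case: unpickle => [[r'|[n i]]|]; [exact: cfb| |exact: cfb].
  by have [] := certP _ (Se n).
- move=> a adec ane ac.
  have [|y ay] := sb_cvg sb adec ane.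
    move=> r; have [i [n]] := ac (pickle (inl r : nat + nat * nat)).
    rewrite /c pickleK => nfb; have [x /nfb[fi _]] := ane n.
    by exists i; split=> //; exists n => z /nfb[].
  exists y => n; have [_ _ /(_ a adec ane)] := certP _ (Se n).
  move=> /(_ _ y ay)[|//] i.
  by have := ac (pickle (inr (n, i) : nat + nat * nat)); rewrite /c pickleK.
- move=> x y /(sb_sep sb)[r rxy]; have [i fi bi] := fbT r x.
  have [n nE] := ebase (pickle (r, i)).
  exists n; rewrite nE /base pickleK; first by [].
  by move=> [_]; exact: rxy.
Qed.

End borel_algebra.

(** * Vaught transforms *)

(** The alias takes the base axioms for [N] as parameters, so that the generated topology can be a
    canonical structure on it. *)
Definition base_space (X : choiceType) (I : Type) (N : I -> set X)
  (Ncover : forall x, exists i, N i x)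
  (Njoin : forall i j x, N i x -> N j x ->
    exists k, N k x /\ N k `<=` N i `&` N j) : Type := X.

Section base_space.
Context {X : choiceType} {I : Type} {N : I -> set X}.
Hypothesis Ncover : forall x, exists i, N i x.
Hypothesis Njoin : forall i j x, N i x -> N j x ->
  exists k, N k x /\ N k `<=` N i `&` N j.

Let op (A : set X) := forall x, A x -> exists i, N i x /\ N i `<=` A.

Let opT : op setT.
Proof. by move=> x _; have [i Nx] := Ncover x; exists i. Qed.

Let opI : setI_closed op.
Proof.
move=> A B oA oB x [/oA[i [Nix iA]] /oB[j [Njx jB]]].
have [k [Nkx kij]] := Njoin Nix Njx; exists k; split=> // y /kij[/iA ? /jB].
by split.
Qed.

Let op_bigU (J : Type) (f : J -> set X) :
  (forall i, op (f i)) -> op (\bigcup_i f i).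
Proof.
move=> of_ x [j _ /(of_ j)[i [Nx ij]]]; exists i; split=> // y /ij fy.
by exists j.
Qed.

Local Notation Y := (base_space Ncover Njoin).

HB.instance Definition _ := Choice.copy Y X.
HB.instance Definition _ := isOpenTopological.Build Y opT opI op_bigU.

Lemma base_space_openE (A : set Y) : open A <-> op A.
Proof. exact: iff_refl. Qed.

Lemma base_space_open_base i : open (N i : set Y).
Proof. by apply/base_space_openE => x Nx; exists i; split. Qed.

Lemma base_space_nbhsE (x : Y) (A : set Y) :
  nbhs x A <-> exists i, N i x /\ N i `<=` A.
Proof.
split=> [|[i [Nx iA]]]; last first.
  by apply: filterS iA _; apply: open_nbhs_nbhs; split=> //; exact: base_space_open_base.
rewrite nbhsE => -[B [/base_space_openE oB Bx] BA].
have [i [Nx iB]] := oB x Bx; exists i; split=> //; exact: subset_trans BA.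
Qed.

End base_space.

(* The Vaught transform, usually written with a triangle as A^{Delta U}; its dual
   A^{* U} is [~` vaught act (~` A) U]. *)
Definition vaught {G : topologicalGroupType} {X : Type} (act : G -> X -> X)
    (A : set X) (U : set G) : set X :=
  [set x | ~ meager (U `&` [set g | A (act g x)])].

Section vaught.
Context {G : topologicalGroupType} {X : topologicalType}.
Context {b : nat -> set G} {fine : nat -> nat -> Prop}.
Hypothesis sb : @sieve_base G b fine.
Variable act : G -> X -> X.
Hypothesis act_left : left_action act.
Hypothesis act_borel : borel_map (prod_borel (borel_sets G) (borel_sets X))
  (borel_sets X) (fun p : G * X => act p.1 p.2).

Implicit Types (A : set X) (U V : set G) (x : X) (g h : G).

Local Notation vt := (vaught act).

Let S := borel_sets X.

Let SC : forall A, S A -> S (~` A) := (@generated_sigma_closed X open).1.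

Let SU : forall (I : countType) (F : I -> set X),
  (forall i, S (F i)) -> S (\bigcup_i F i) := (@generated_sigma_closed X open).2.

Let S0 : S set0. Proof. by apply: sub_gen_smallest; exact: open0. Qed.

(** Both claims go through one induction, because complements in the second need the first: the
    complement of a section is nonmeagre in [b i] exactly if the section is meagre in some nonempty
    basic subset of [b i]. *)
Lemma prod_borel_section (E : set (G * X)) :
  prod_borel (borel_sets G) (borel_sets X) E ->
  (forall x, locally_comeager b [set g | E (g, x)]) /\
  forall i, S [set x | ~ meager (b i `&` [set g | E (g, x)])].
Proof.
move: E; apply: generated_sigma_algebra_ind.
- move=> _ [A SA [B SB <-]]; have sec x : [set g | (A `*` B) (g, x)] =
      if pselect (B x) then A else set0.
    by case: pselect => Bx /=; apply/seteqP; split=> [g []|g].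
  split=> [x|i].
    rewrite sec; case: pselect => Bx /=; first exact: (locally_comeager_borel sb).
    exact/(locally_comeager_open sb)/open0.
  have [mA|nmA] := pselect (meager (b i `&` A)).
    rewrite (_ : [set _ | _] = set0)// -subset0 => x /=; apply; rewrite sec.
    by case: pselect => Bx //=; rewrite setI0; exact: meager0.
  rewrite (_ : [set _ | _] = B)//; apply/seteqP; split=> x /=; rewrite sec.
    by case: pselect => Bx //=; rewrite setI0 => /(_ meager0).
  by case: pselect.
- have l0 : locally_comeager b (@set0 G) by exact/(locally_comeager_open sb)/open0.
  split=> [x|i]; first by [].
  rewrite (_ : [set _ | _] = set0)// -subset0 => x /=; apply.
  by rewrite (_ : [set _ | _] = set0)// setI0; exact: meager0.
- move=> E [El ES]; split=> [x|i]; first exact: (locally_comeager_setC sb (El x)).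
  pose good j := b j `<=` b i /\ b j !=set0.
  rewrite (_ : [set _ | _] = \bigcup_j (if pselect (good j) then
    ~` [set x | ~ meager (b j `&` [set g | E (g, x)])] else set0)).
    by apply: SU => j; case: pselect => ? //=; exact: SC.
  apply/seteqP; split=> x.
    move=> /(locally_comeager_setC sb (El x) (sb_open sb i))[j [ji j0 mj]].
    exists j => //; case: pselect => [_|[]//] /=; rewrite notK.
    by move: mj; rewrite setCK.
  move=> [j _]; case: pselect => // -[ji j0] /= /contrapT mj mi.
  apply: (sieve_base_baire sb (sb_open sb j) j0).
  apply: meagerS (meagerU mj mi) => g bg.
  by have [Eg|nEg] := pselect (E (g, x)); [left|right; split=> //; exact: ji].
- move=> F FP; split=> [x|i].
    rewrite (_ : [set _ | _] = \bigcup_n [set g | F n (g, x)]).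
      by apply: locally_comeager_bigcup => n; exact: (FP n).1.
    by apply/seteqP; split=> g [n _ Fg]; exists n.
  rewrite (_ : [set _ | _] = \bigcup_n [set x | ~ meager (b i `&` [set g | F n (g, x)])]).
    by apply: SU => n; exact: (FP n).2.
  apply/seteqP; split=> x.
    move=> nm; have [|n nn] := @nonmeager_cover _ nat _
        (fun n => b i `&` [set g | F n (g, x)]) nm; last by exists n.
    by move=> g [bg [n _ Fg]]; exists n.
  move=> [n _ nm] m; apply: nm; apply: meagerS m => g [bg Fg].
  by split=> //; exists n.
Qed.

Lemma orbit_locally_comeager A x : S A -> locally_comeager b [set g | A (act g x)].
Proof. by move=> /act_borel/prod_borel_section[h _]; exact: h. Qed.

Lemma vaught_borel A i : S A -> S (vt A (b i)).
Proof. by move=> /act_borel/prod_borel_section[_ h]; exact: h. Qed.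

Lemma vaughtS A B U V : A `<=` B -> U `<=` V -> vt A U `<=` vt B V.
Proof.
move=> AB UV x nm m; apply: nm; apply: meagerS m => g [Ug Ag].
by split; [exact: UV|exact: AB].
Qed.

Lemma vaught_ex A U x : vt A U x -> exists2 g, U g & A (act g x).
Proof. by move=> /nonmeager_nonempty[g [Ug Ag]]; exists g. Qed.

(** Replaces a choice made for each [g] among countably many options by one option valid for
    nonmeagrely many [g]. In the applications, unsuitable options get the empty set as [V i]. *)
Lemma vaught_cover (I : countType) A U x (F : I -> set X) (V : I -> set G) :
  vt A U x ->
  (forall g, U g -> A (act g x) -> exists i, V i g /\ F i (act g x)) ->
  exists i, vt (F i) (V i) x.
Proof.
move=> nm h; apply: (nonmeager_cover nm) => g [Ug Ag].
by have [i [Vg Fg]] := h g Ug Ag; exists i.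
Qed.

Let mulr_cont g : continuous (fun h : G => (h * g)%g).
Proof.
move=> h; apply: (@continuous_comp _ _ _ (fun h : G => (h, g))
  (fun p : G * G => (p.1 * p.2)%g)).
  by apply: cvg_pair => //; exact: cvg_cst.
exact: mulg_continuous.
Qed.

(** The set on the right is [U g]; right translations are homeomorphisms of [G] and so preserve
    meagreness. *)
Lemma vaught_act A U g x :
  vt A U (act g x) <-> vt A [set h | U (h * g^-1)%g] x.
Proof.
have [_ actM] := act_left.
have mK k : cancel (fun h : G => (h * k)%g) (fun h => (h * k^-1)%g).
  by move=> h; rewrite mulgK.
have mVK k : cancel (fun h : G => (h * k^-1)%g) (fun h => (h * k)%g).
  by move=> h; rewrite mulgVK.
split=> nm m; apply: nm.
  have := meager_preimage_homeo (@mulr_cont g) (@mulr_cont g^-1%g) (mK g) (mVK g) m.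
  by apply: meagerS => h [Uh Ah]; split => /=; rewrite ?mulgK// actM.
have := meager_preimage_homeo (@mulr_cont g^-1%g) (@mulr_cont g) (mVK g) (mK g) m.
by apply: meagerS => h [Uh Ah]; split => //=; rewrite -actM mulgVK.
Qed.

Lemma base_mul V h g : open V -> V (h * g)%g -> exists i j,
  [/\ b i h, b j g & forall h' g', b i h' -> b j g' -> V (h' * g')%g].
Proof.
move=> Vo Vhg; have /= := @mulg_continuous G (h, g) V (open_nbhs_nbhs (conj Vo Vhg)).
move=> [[P Q] [/= Ph Qg] PQ].
have [i [bih iP _]] := sb_nbhs sb 0%N Ph; have [j [bjg jQ _]] := sb_nbhs sb 0%N Qg.
exists i, j; split=> // h' g' bih' bjg'; apply: (PQ (h', g')); split=> /=.
  exact/iP/subset_closure.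
exact/jQ/subset_closure.
Qed.

Lemma base_div V h g : open V -> V (h * g^-1)%g -> exists i j,
  [/\ b i h, b j g & forall h' g', b i h' -> b j g' -> V (h' * g'^-1)%g].
Proof.
move=> Vo /(base_mul Vo)[i [k [bi bk ik]]].
have [j [bj jk _]] := sb_nbhs sb 0%N
  (@invg_continuous G g _ (open_nbhs_nbhs (conj (sb_open sb k) bk))).
exists i, j; split=> // h' g' bih' bjg'; apply: ik => //.
exact/jk/subset_closure.
Qed.

End vaught.

(** * The topology generated by the Vaught transforms *)

Section vaught_topology.
Context {G : topologicalGroupType} {X : topologicalType}.
Context {b : nat -> set G} {fine : nat -> nat -> Prop}.
Hypothesis sb : @sieve_base G b fine.
Variable act : G -> X -> X.
Hypothesis act_left : left_action act.
Hypothesis act_borel : borel_map (prod_borel (borel_sets G) (borel_sets X))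
  (borel_sets X) (fun p : G * X => act p.1 p.2).
Variables (e : nat -> set X) (c : nat -> nat -> set X).
Hypothesis e_borel : forall n, borel_sets X (e n).
Hypothesis eC : forall n, exists l, e l = ~` e n.
Hypothesis eI : forall m n, exists l, e l = e m `&` e n.
Hypothesis eV : forall n i, exists l, e l = vaught act (e n) (b i).
Hypothesis c_e : forall r j, exists n, e n = c r j.
Hypothesis c_cover : forall r, \bigcup_j c r j = setT.
Hypothesis e_cvg : forall a : nat -> set X, (forall n, a n.+1 `<=` a n) ->
  (forall n, a n !=set0) -> (forall r, exists j n, a n `<=` c r j) ->
  exists y : X, forall n, e n y -> exists m, a m `<=` e n.
Hypothesis e_sep : forall x y, x <> y -> exists2 n, e n x & ~ e n y.

Local Notation vt := (vaught act).

Let N (ni : nat * nat) : set X := vt (e ni.1) (b ni.2).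

Let eT : exists l, e l = setT.
Proof.
have [m mE] := eC 0; have [n nE] := eI 0 m; have [l lE] := eC n.
by exists l; rewrite lE nE mE setICr setC0.
Qed.

Let mulsub i j (V : set G) := forall h g, b i h -> b j g -> V (h * g)%g.

Let vaught_set0 A x : ~ vt A set0 x.
Proof. by move=> /vaught_ex[]. Qed.

(** Countably many [b i] with [b i b j] inside [V] for some [b j] around [g] cover [V g^-1], so one
    of them carries the transform. By [vaught_untranslate], the pair found for this [g] then serves
    every element of [b j]. *)
Let vaught_translate A V x g : open V -> vt A V x ->
  exists i j, [/\ b j g, mulsub i j V & vt A (b i) (act g x)].
Proof.
move=> Vo Vx; have [act1 actM] := act_left.
have : vt A V (act g^-1%g (act g x)) by rewrite -actM mulVg act1.
move=> /(vaught_act act_left)/(@vaught_cover _ _ _ (nat * nat)%type _ _ _ (fun=> A)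
  (fun ij => if pselect (b ij.2 g /\ mulsub ij.1 ij.2 V) then b ij.1 else set0)).
case=> [h|[i j]] /=.
  rewrite invgK => /(base_mul sb Vo)[i [j [bi bj ij]]] Ah; exists (i, j); split=> //.
  by case: pselect => // -[].
by case: pselect => [[bj ij] ?|_ /vaught_set0//]; exists i, j.
Qed.

Let vaught_untranslate A V i j x g :
  b j g -> mulsub i j V -> vt A (b i) (act g x) -> vt A V x.
Proof.
move=> bj ij /(vaught_act act_left); apply: vaughtS => // h /= bi.
by rewrite -(mulgVK g h); exact: ij.
Qed.

Let N_ex ni (x : X) : N ni x -> exists2 g, b ni.2 g & e ni.1 (act g x).
Proof. exact: vaught_ex. Qed.

Let N_top : exists ni, N ni = setT.
Proof.
have [l lE] := eT; have [i iE] := sb_top sb; exists (l, i).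
rewrite -subTset => x _; rewrite /N/= lE iE /vaught/= (_ : _ `&` _ = setT).
  by apply: (sieve_base_baire sb openT); exists 1%g.
by rewrite -subTset.
Qed.

Let N_cover x : exists ni, N ni x.
Proof. by have [ni NT] := N_top; exists ni; rewrite NT. Qed.

(** For each [g] witnessing the first transform, [g x] lies in some [(e n)^(b i')] that pulls back
    into the second. Intersecting [e m] with this transform, again a member of the algebra, gives
    the common refinement. *)
Let N_join mi nj x : N mi x -> N nj x ->
  exists lk, N lk x /\ N lk `<=` N mi `&` N nj.
Proof.
case: mi nj => m i [n j]; rewrite /N/= => mx nx.
pose good (k : nat * nat * nat) :=
  mulsub k.1.1 k.1.2 (b j) /\ b k.2 `<=` b i `&` b k.1.2.
have [|[[i' j'] k]] := @vaught_cover _ _ _ (nat * nat * nat)%type _ _ _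
  (fun k => e m `&` vt (e n) (b k.1.1))
  (fun k => if pselect (good k) then b k.2 else set0) mx.
  move=> g big mg; have [i' [j' [bj' ij' n']]] := vaught_translate g (sb_open sb j) nx.
  have [k [bk kij _]] := sb_nbhs sb 0%N (open_nbhs_nbhs
    (conj (openI (sb_open sb i) (sb_open sb j')) (conj big bj'))).
  exists (i', j', k); split=> //; case: pselect => // -[]; split=> //.
  exact: subset_trans (@subset_closure _ _) kij.
rewrite /good/=; case: pselect => [[ij' kij] kx|_ /vaught_set0//].
have [l lE] := eV n i'; have [l' l'E] := eI m l.
exists (l', k); rewrite l'E lE /=; split=> // y ky; split.
  by apply: vaughtS ky => [z []//|g /kij[]].
have [g /kij[_ bj'] [_ ng]] := vaught_ex ky.
exact: vaught_untranslate bj' ij' ng.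
Qed.

Local Notation Y := (base_space N_cover N_join).

Let N_open ni : @open Y (N ni).
Proof. exact: base_space_open_base. Qed.

Let closed_dual_vaught n i : @closed Y (~` vt (e n) (b i)).
Proof. exact: (@open_closedC Y (N (n, i)) (@N_open _)). Qed.

(* With A = e n: choose V, then K around 1 and U' in V so small that V K lies in
   a basic set where x is in A^*, and U' K^-1 in V.  The neighbourhood (A^{* V})^K
   of x is then contained in the closed set A^{* U'}. *)
Let N_regular (x : Y) A : nbhs x A ->
  exists ni, N ni x /\ @closure Y (N ni) `<=` A.
Proof.
move=> /base_space_nbhsE[[n i] [Nx NA]].
have [l [li [w bw] ml]] :=
  orbit_locally_comeager sb act_borel (x := x) (e_borel n) (sb_open sb i) Nx.
have bw1 : b l (w * 1)%g by rewrite mulg1.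
have [v [p [bv bp vp]]] := base_mul sb (sb_open sb l) bw1.
have bwV1 : b v (w * 1^-1)%g by rewrite invg1 mulg1.
have [u [q [bu bq uq]]] := base_div sb (sb_open sb v) bwV1.
have [k [bk kpq _]] := sb_nbhs sb 0%N (open_nbhs_nbhs
  (conj (openI (sb_open sb p) (sb_open sb q)) (conj bp bq))).
have {}kpq : b k `<=` b p `&` b q by exact: subset_trans (@subset_closure _ _) kpq.
(* With [V] for [b v], [e d] is [A^{* V}]. *)
have [nC nCE] := eC n; have [vC vCE] := eV nC v; have [d dE] := eC vC.
exists (d, k).
have sub : (N (d, k) : set X) `<=` ~` vt (e nC) (b u).
  move=> y /N_ex[g /kpq[_ bqg]]; rewrite /= dE vCE => nv nu; apply: nv.
  apply/(vaught_act act_left); apply: vaughtS nu => // h bh; exact: uq.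
split.
  rewrite /N/= dE vCE => mk; apply: (sieve_base_baire sb (sb_open sb k)).
    by exists 1%g.
  apply: meagerS mk => g bkg; split=> //= /(vaught_act act_left); apply.
  rewrite nCE; apply: meagerS ml => h [/= bvh nh]; split=> //.
  by rewrite -(mulgVK g h); apply: vp => //; case: (kpq g bkg).
move=> y /(@closureS Y _ _ sub); rewrite -(closure_id _).1//= => nu.
apply: NA => mi; apply: nu; rewrite nCE => mu.
apply: (sieve_base_baire sb (sb_open sb u)); first by exists w.
apply: meagerS (meagerU mi mu) => h bh.
have [Ah|nAh] := pselect (e n (act h y)); [left|by right].
(* Since [1] lies in [b q] and [b p], [b u] is contained in [b v] and [b v] in [b l], hence in
   [b i]. *)
split=> //; apply: li; rewrite -(mulg1 h); apply: vp => //.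
by rewrite -(mulg1 h) -invg1; exact: uq.
Qed.

(** If [x] and [y] differ, a single [e n] contains [g x] but not [g y] for nonmeagrely many [g],
    hence for comeagrely many [g] in some [b k]. Then [N (n, k)] separates the points. *)
Let N_T0 (x y : Y) : (forall A, nbhs x A -> A y) -> x = y.
Proof.
move=> xy; apply: contrapT => nxy; have [act1 actM] := act_left.
pose E n := [set g | e n (act g x)] `&` ~` [set g | e n (act g y)].
have [|n nE] := @nonmeager_cover _ nat setT E (sieve_base_baire sb openT (ex_intro _ 1%g I)).
  move=> g _; have [|n nx ny] := @e_sep (act g x) (act g y); last by exists n.
  by move=> /(congr1 (act g^-1%g)); rewrite -!actM mulVg !act1.
have lx := orbit_locally_comeager sb act_borel (x := x) (e_borel n).
have ly := orbit_locally_comeager sb act_borel (x := y) (e_borel n).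
rewrite -(setTI (E n)) in nE.
have [k [_ k0 mk]] :=
  locally_comeagerI sb lx (locally_comeager_setC sb ly) openT nE.
have : N (n, k) y.
  apply: xy; apply/base_space_nbhsE; exists (n, k); split=> // m.
  apply: (sieve_base_baire sb (sb_open sb k) k0).
  apply: meagerS (meagerU m mk) => g bg.
  have [Eg|nEg] := pselect (e n (act g x)); [by left|right; split=> //].
  by move=> [].
by apply; apply: meagerS mk => g [bg eg]; split=> // -[].
Qed.

(** The set [U g0] is covered by countably many [b k] with [b k (b j)^-1] inside [U] for some [b j]
    around [g0]; a [b k] carrying the transform at [x0] gives the neighbourhood. *)
Let act_continuous : continuous (fun p : G * Y => act p.1 p.2 : Y).
Proof.
move=> [g0 x0] A /= /base_space_nbhsE[[n i] [/(vaught_act act_left) Nx NA]].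
pose divsub k j := forall h g, b k h -> b j g -> b i (h * g^-1)%g.
have [|[k j] /=] := @vaught_cover _ _ _ (nat * nat)%type _ _ _ (fun=> e n)
  (fun kj => if pselect (b kj.2 g0 /\ divsub kj.1 kj.2) then b kj.1 else set0) Nx.
  move=> h /= /(base_div sb (sb_open sb i))[k [j [bk bj kj]]] eh.
  by exists (k, j); split=> //; case: pselect => // -[].
case: pselect => [[bj kj] kx|_ /vaught_set0//].
exists (b j, N (n, k)); first split=> /=.
- by apply: open_nbhs_nbhs; split=> //; exact: (sb_open sb).
- by apply/base_space_nbhsE; exists (n, k); split.
move=> [g x] /= [bg Nkx]; apply: NA; apply/(vaught_act act_left).
by apply: vaughtS Nkx => // h bh; exact: (kj).
Qed.

Let below r (w w' : nat * nat) :=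
  [/\ e w'.1 `<=` e w.1, closure (b w'.2) `<=` b w.2, fine r w'.2 &
      exists j, e w'.1 `<=` c r j].

Let N_below r w x : N w x -> exists2 w', below r w w' & N w' x.
Proof.
case: w => n i; rewrite [N _]/N /= => Nx.
have [|[j k] /=] := @vaught_cover _ _ _ (nat * nat)%type _ _ _
  (fun jk => e n `&` c r jk.1)
  (fun jk => if pselect (closure (b jk.2) `<=` b i /\ fine r jk.2)
             then b jk.2 else set0) Nx.
  move=> g /= bg eg; have : setT (act g x) by [].
  rewrite -(c_cover r) => -[j _ cj].
  have [k [bk ki fk]] := sb_nbhs sb r (open_nbhs_nbhs (conj (sb_open sb i) bg)).
  by exists (j, k); split=> //; case: pselect => // -[].
case: pselect => [[ki fk] kx|_ /vaught_set0//].
have [m mE] := c_e r j; have [l lE] := eI n m.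
exists (l, k); last by rewrite /N/= lE mE.
by split=> //=; [rewrite lE => y []|exists j; rewrite lE mE => y []].
Qed.

(** If [g^-1 y] lies in [A^U], then [y] lies in some [A^(b k)] with [b k b j] inside [U] and [g] in
    [b j]. As this transform is in the algebra, the sets [e (w r).1] enter it and the [b (w r).2]
    enter [b j]; so points of [N (w r)] end up in [A^U]. *)
Let N_cvg (w : nat -> nat * nat) : (forall r, below r (w r) (w r.+1)) ->
  (forall r, N (w r) !=set0) ->
  exists x : Y, forall A, nbhs x A -> exists r, N (w r) `<=` A.
Proof.
move=> wbelow wne; have [act1 actM] := act_left.
have edec r : e (w r.+1).1 `<=` e (w r).1 by have [] := wbelow r.
have bcl r : closure (b (w r.+1).2) `<=` b (w r).2 by have [] := wbelow r.
have bdec r : b (w r.+1).2 `<=` b (w r).2.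
  exact: subset_trans (@subset_closure _ _) (bcl r).
have ene r : e (w r).1 !=set0.
  by have [x /N_ex[g _ eg]] := wne r; exists (act g x).
have bne r : b (w r).2 !=set0 by have [x /N_ex[g bg _]] := wne r; exists g.
have [|y ey] := e_cvg edec ene.
  by move=> r; have [_ _ _ [j cj]] := wbelow r; exists j, r.+1.
have [|g bg] := sb_cvg sb bdec bne.
  by move=> r; have [_ _ fr _] := wbelow r; exists (w r.+1).2; split=> //; exists r.+1.
exists (act g^-1%g y) => A /base_space_nbhsE[[n i] [Nx NA]].
have [k [j [bj kj]]] := vaught_translate g (sb_open sb i) Nx.
rewrite -actM mulgV act1; have [l lE] := eV n k; rewrite -lE => /ey[r1 r1l].
have [r2 r2j] := bg _ (open_nbhs_nbhs (conj (sb_open sb j) bj)).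
exists (maxn r1 r2) => z /N_ex[h bh eh]; apply: NA.
apply: (@vaught_untranslate _ _ k j z h) => //=.
  exact/r2j/(decreasing_seqS bdec (leq_maxr r1 r2)).
by rewrite -lE; apply/r1l/(decreasing_seqS edec (leq_maxl r1 r2)).
Qed.

Lemma vaught_topology_polish (R : realType) : exists (T : topologicalType)
    (actT : G -> T -> T) (f : X -> T),
  [/\ polish_Gspace R actT, bijective f, borel_map (borel_sets X) (borel_sets T) f &
      forall g x, f (act g x) = actT g (f x)].
Proof.
exists Y, act, id; split=> //.
- split=> //; pose M n : set Y := if unpickle n is Some ni then N ni else set0.
  apply: (@polish_sieve R Y _ M N below) => //.
  + by move=> n; rewrite /M; case: unpickle => [ni|]; [exact: N_open|exact: open0].
  + by move=> x A /N_regular[ni [Nx NA]]; exists (pickle ni); rewrite /M pickleK.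
- by exists id.
(* New open sets are countable unions of transforms, which are Borel for the old topology. *)
- apply: smallest_sub; first exact: smallest_sigma_algebra.
  move=> A /base_space_openE Ao.
  have -> : A = \bigcup_ni (if pselect (N ni `<=` A) then N ni else set0).
    apply/seteqP; split=> [x /Ao[ni [Nx NA]]|x [ni _]].
      by exists ni => //; case: pselect.
    by case: pselect => //= NA /NA.
  apply: (@generated_sigma_closed X open).2 => ni.
  case: pselect => _ /=; first exact: (vaught_borel sb act_borel).
  by apply: sub_gen_smallest; exact: open0.
Qed.

End vaught_topology.

Theorem theorem1p1 (R : realType) (G : topologicalGroupType) (polG : polish R G)
    (X : Type) (S : set (set X)) (act : G -> X -> X)
    (XP : borel_Gspace R S act) :
  exists (Y : topologicalType) (actY : G -> Y -> Y),
    polish_Gspace R actY /\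
    borel_Gspace_isomorphic S act (borel_sets Y) actY.
Proof.
case: XP => -[cX []]; set T : topologicalType := Topological.Pack cX.
move=> polX -> act_left act_borel.
have [b [fine sb]] := polish_sieve_base polG.
have [bX [fineX sbX]] := polish_sieve_base polX.
(* Repeating an index as both arguments turns closure under [op] into closure under the unary
   operations. *)
pose op k (A B : set T) := match k with
  | 0%N => ~` A
  | 1%N => A `&` B
  | i.+2 => vaught act A (b i)
  end.
have Sop k A B : borel_sets T A -> borel_sets T B -> borel_sets T (op k A B).
  have sigT := @generated_sigma_closed T open.
  case: k => [|[|i]] /= SA SB; [exact: sigT.1|exact: (sigma_closedI sigT)|].
  exact: (@vaught_borel G T b fine sb act act_borel).
have [e [c [[eS eop] ce cT ecvg esep]]] := borel_algebra sbX Sop.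
have [Y [actY [f [polY bijf borf eqf]]]] := @vaught_topology_polish G T b fine sb
  act act_left act_borel e c eS (fun n => eop 0%N n n) (eop 1%N)
  (fun n i => eop i.+2 n n) ce cT ecvg esep R.
by exists Y, actY; split=> //; exists f.
Qed.
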